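(* Let $n$ be a positive integer and let the edge weights $w_{ij}$ ($1\le i<j\le n$) and vertex weights $v_k$ ($1\le k\le n$) be chosen independently and uniformly at random from $\{0,\dots,7\}$. Let $\omega=e^{i\pi/8}$ and $$Z_R=\sum_{z\in\{\pm1\}^n}\omega^{\sum_{i<j}w_{ij}z_iz_j+\sum_{k=1}^n v_kz_k}.$$ Then $\mathbb{E}_{w,v}\left[|Z_R|^4\right]\le3\cdot2^{2n}$.
   Context: $Z_R$ is the complex-temperature partition function of a random Ising model on the complete graph on $n$ vertices; the expectation is over the random weights. *)

(* Defs.v *)
From mathcomp Require Import all_boot all_order all_algebra.
From mathcomp Require Import complex.
From mathcomp Require Import reals trigo.

Set Implicit Arguments.
Unset Strict Implicit.
Unset Printing Implicit Defensive.

Import Order.TTheory GRing.Theory Num.Theory.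

Local Open Scope ring_scope.
Local Open Scope complex_scope.

Notation edge n := {e : 'I_n * 'I_n | (e.1 < e.2)%N}.

Notation edge_weights n := {ffun edge n -> 'I_8}.

Notation vertex_weights n := {ffun 'I_n -> 'I_8}.

(* Expectation for the uniform distribution on T. On a product of finite sets
   this distribution is the joint law of independent uniform coordinates. *)
Definition uniform_expectation (R : realType) (T : finType) (X : T -> R) : R :=
  (\sum_(t : T) X t) / #|T|%:R.

(* exp (i pi / 8), written out by Euler's formula. *)
Definition omega (R : realType) : R[i] := cos (pi / 8) +i* sin (pi / 8).

(* z in {1, -1}^n is encoded by booleans: z_k = (-1) ^ (s k). *)
Definition spin (n : nat) (s : {ffun 'I_n -> bool}) (k : 'I_n) : int :=
  (-1) ^+ s k.

Definition ising_exponent (n : nat) (w : edge_weights n) (v : vertex_weights n)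
    (s : {ffun 'I_n -> bool}) : int :=
  \sum_(e : edge n) (w e)%:Z * spin s (val e).1 * spin s (val e).2
  + \sum_(k < n) (v k)%:Z * spin s k.

(* The exponent is a possibly negative integer, hence the power by an int. *)
Definition Z_R (R : realType) (n : nat) (w : edge_weights n)
    (v : vertex_weights n) : R[i] :=
  \sum_(s : {ffun 'I_n -> bool}) omega R ^ ising_exponent w v s.

(* Main.v *)
(** Expanding |Z_R|^4 = |Z_R^2|^2 gives a sum over two pairs of configurations
    p = (a, b) and q = (c, d).  Averaging over one weight kills every term whose
    coefficient t is nonzero: t is even with |t| <= 4, so omega^t is an
    eighth root of unity, and it is not 1 because omega^8 = -1.  What survives is
      a_k + b_k = c_k + d_k   and   a_i a_j + b_i b_j = c_i c_j + d_i d_j,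
    which forces {a, b} = {c, d}; there are at most 2 * 4^n such quadruples. *)
Require Import Defs.
From mathcomp Require Import all_boot all_order all_algebra.
From mathcomp Require Import complex.
From mathcomp Require Import reals.
From mathcomp Require Import trigo.
From mathcomp Require Import ring lra.

Import Order.TTheory GRing.Theory Num.Theory.

Local Open Scope ring_scope.

Section Omega.
Variable R : realType.
Notation w := (omega R).

Lemma omega8 : w ^+ 8 = -1.
Proof.
have sq (x y : R) : ((x +i* y) ^+ 2 = (x ^+ 2 - y ^+ 2) +i* (x * y *+ 2))%C.
  by rewrite expr2; apply/eqP; rewrite eq_complex; apply/andP; split; apply/eqP => /=; ring.
have dbl (x : R) : ((cos x +i* sin x) ^+ 2 = cos (x *+ 2) +i* sin (x *+ 2))%C.
  by rewrite sq (mulr2n x) cosD sinD; congr (_ +i* _)%C; ring.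
(* Three angle doublings carry [pi / 8] to [pi]. *)
rewrite (_ : 8 = 2 * (2 * 2))%N // !exprM /omega !dbl.
have -> : (pi / 8 *+ 2 *+ 2 *+ 2 : R) = pi by field.
by rewrite cospi sinpi; apply/eqP; rewrite eq_complex /= oppr0 !eqxx.
Qed.

Lemma omega_neq0 : w != 0.
Proof.
apply: contraTneq isT => w0; have := omega8.
by rewrite w0 expr0n /= => /eqP; rewrite eq_sym oppr_eq0 oner_eq0.
Qed.

(** Since [w ^+ 8 = -1], the norm of [w] is 1, so conjugation inverts its powers. *)
Lemma conjC_omegaX (m : int) : (w ^ m)^* = w ^ (- m).
Proof.
have nw : `|w| = 1.
  apply/eqP; rewrite -(@pexpr_eq1 _ _ 8) // -normrX omega8 normrN1 //.
by rewrite fmorphXz -exprz_inv invC_norm nw expr1n invr1 mul1r.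
Qed.

Lemma sum_omega (t : int) : t \in [:: -4; -2; 2; 4] ->
  \sum_(x < 8) w ^ (x%:Z * t) = 0.
Proof.
move=> ht; have w8 : w ^ (8 : int) = -1 by rewrite -exprnP omega8.
have neq : w ^ t != 1.
  (* Each listed [t] divides 8, so [w ^ t = 1] would give [w ^ 8 = 1]. *)
  have [k kt] : exists k : int, t * k = 8.
    by move: ht; rewrite !inE => /or4P[] /eqP->;
      [exists (-2)|exists (-4)|exists 4|exists 2].
  apply/eqP => /(congr1 (fun x => x ^ k)) /=; rewrite exprz_exp kt w8 exp1rz => /eqP.
  by rewrite eq_sym -subr_eq0 opprK -mulr2n pnatr_eq0.
have one : (w ^ t) ^+ 8 = 1.
  rewrite exprnP exprz_exp mulrC -exprz_exp w8.
  by move: ht; rewrite !inE => /or4P[] /eqP->; rewrite -?invr_expz -exprnP;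
    rewrite -signr_odd /= ?expr0 ?invr1.
(* Geometric sum: its product with the nonzero factor [w ^ t - 1] is [(w ^ t) ^+ 8 - 1 = 0]. *)
have := subrX1 (w ^ t) 8; rewrite one subrr => /esym/eqP.
rewrite mulf_eq0 subr_eq0 (negbTE neq) /= => /eqP sum0; rewrite -[RHS]sum0.
by apply: eq_bigr => i _; rewrite exprnP exprz_exp mulrC.
Qed.

(** Independence of the weights: the sum factors into one sum over ['I_8] per coordinate, and a
    single nonzero coefficient makes its factor vanish. *)
Lemma sum_omega_weights (I J : finType) (t : I -> int) (u : J -> int) :
  (forall i, t i \in [:: 0; -4; -2; 2; 4]) ->
  (forall j, u j \in [:: 0; -4; -2; 2; 4]) ->
  \sum_(x : {ffun I -> 'I_8} * {ffun J -> 'I_8})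
     w ^ (\sum_i (x.1 i)%:Z * t i + \sum_j (x.2 j)%:Z * u j)
  = if [forall i, t i == 0] && [forall j, u j == 0]
    then #|{: {ffun I -> 'I_8} * {ffun J -> 'I_8}}|%:R else 0.
Proof.
move=> ht hu.
have wD := fun m n => @expfzDr _ w m n omega_neq0.
have wS (K : finType) (F : K -> int) : w ^ (\sum_k F k) = \prod_k w ^ F k.
  by apply: (big_morph (fun m => w ^ m)) => [m n|]; rewrite ?expr0z.
have factor0 (K : finType) (s : K -> int) :
    (forall k, s k \in [:: 0; -4; -2; 2; 4]) -> ~~ [forall k, s k == 0] ->
    \sum_(x : {ffun K -> 'I_8}) w ^ (\sum_k (x k)%:Z * s k) = 0.
  move=> hs /forallPn[k sk].
  under eq_bigr do rewrite wS.
  rewrite -(bigA_distr_bigA (fun k (x : 'I_8) => w ^ (x%:Z * s k))) /=.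
  rewrite (bigD1 k) //= sum_omega ?mul0r //.
  (* With 0 at its head, the list of allowed values loses exactly that entry and becomes the one in
     [sum_omega]. *)
  by have := hs k; rewrite inE (negbTE sk).
case: ifPn => [/andP[/forallP t0 /forallP u0]|].
  rewrite -sum1_card natr_sum; apply: eq_bigr => x _.
  by rewrite !big1 ?addr0 // => k _; rewrite ?(eqP (t0 k)) ?(eqP (u0 k)) mulr0.
under eq_bigr do rewrite wD.
rewrite -(pair_bigA _ (fun x y : {ffun _ -> 'I_8} =>
   w ^ (\sum_i (x i)%:Z * t i) * w ^ (\sum_j (y j)%:Z * u j))) /=.
rewrite -big_distrlr /= negb_and => /orP[] /factor0 -> //.
- by rewrite mul0r.
- by rewrite mulr0.
Qed.

End Omega.

Section Configurations.
Variable n : nat.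
Notation config := {ffun 'I_n -> bool}.
Implicit Types p q : config * config.

(** The coefficient of the weight of [e] in the exponent of the term indexed by [p] and [q]; the
    entries of [q] count negatively because they come from the conjugate. *)
Definition edge_defect p q (e : edge n) : int :=
  spin p.1 (val e).1 * spin p.1 (val e).2 + spin p.2 (val e).1 * spin p.2 (val e).2
  - (spin q.1 (val e).1 * spin q.1 (val e).2 + spin q.2 (val e).1 * spin q.2 (val e).2).

Definition vertex_defect p q (k : 'I_n) : int :=
  spin p.1 k + spin p.2 k - (spin q.1 k + spin q.2 k).

Lemma edge_defect_range p q e : edge_defect p q e \in [:: 0; -4; -2; 2; 4].
Proof.
rewrite /edge_defect /spin.
by do 2!case: (p.1 _); do 2!case: (p.2 _); do 2!case: (q.1 _); do 2!case: (q.2 _).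
Qed.

Lemma vertex_defect_range p q k : vertex_defect p q k \in [:: 0; -4; -2; 2; 4].
Proof. by rewrite /vertex_defect /spin;
  case: (p.1 k); case: (p.2 k); case: (q.1 k); case: (q.2 k). Qed.

Lemma ising_exponent_defect (x : edge_weights n) (v : vertex_weights n) p q :
  ising_exponent x v p.1 + ising_exponent x v p.2
    - (ising_exponent x v q.1 + ising_exponent x v q.2)
  = \sum_e (x e)%:Z * edge_defect p q e + \sum_k (v k)%:Z * vertex_defect p q k.
Proof.
rewrite /ising_exponent.
under [X in _ = X + _]eq_bigr do
  rewrite /edge_defect mulrBr !mulrDr !mulrA.
under [X in _ = _ + X]eq_bigr do rewrite /vertex_defect mulrBr !mulrDr.
rewrite !sumrB !big_split /=; ring.
Qed.

(** If a_k != c_k, the vertex equation at k gives b_k = c_k = -a_k and d_k = a_k. For j != k the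
    edge equation then reads a_j - b_j = d_j - c_j, which with a_j + b_j = c_j + d_j yields c_j =
    b_j and d_j = a_j. *)
Lemma defect0_swap p q :
  (forall e, edge_defect p q e = 0) -> (forall k, vertex_defect p q k = 0) ->
  q = p \/ q = (p.2, p.1).
Proof.
case: p q => [a b] [c d] /= E V.
have [ac|/eqP/ffunP neq] := eqVneq a c.
  left; congr pair => //; apply/ffunP => k.
  by have := V k; rewrite /vertex_defect /spin /= ac; case: (b k); case: (c k); case: (d k).
right.
have [k ak] : exists k, a k != c k.
  apply/existsP; apply: contra_notT neq => /existsPn h k.
  by apply/eqP; have := h k; rewrite negbK.
have swap j : c j = b j /\ d j = a j.
  have [jk|jk|/val_inj jk] := ltngtP j k.
  - have := E (exist _ (j, k) jk); have := V k; have := V j; move: ak.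
    rewrite /edge_defect /vertex_defect /spin /=.
    by case: (a k); case: (b k); case: (c k); case: (d k);
      case: (a j); case: (b j); case: (c j); case: (d j).
  - have := E (exist _ (k, j) jk); have := V k; have := V j; move: ak.
    rewrite /edge_defect /vertex_defect /spin /=.
    by case: (a k); case: (b k); case: (c k); case: (d k);
      case: (a j); case: (b j); case: (c j); case: (d j).
  - subst j; have := V k; move: ak; rewrite /vertex_defect /spin /=.
    by case: (a k); case: (b k); case: (c k); case: (d k).
by congr pair; apply/ffunP => j; case: (swap j).
Qed.

Lemma normc_Z_R4 (R : realType) (x : edge_weights n) (v : vertex_weights n) :
  ((Normc.normc (Z_R R x v) ^+ 4)%:C)%C =
  \sum_(p : config * config) \sum_(q : config * config)
    omega R ^ (\sum_e (x e)%:Z * edge_defect p q e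
               + \sum_k (v k)%:Z * vertex_defect p q k).
Proof.
have wD := fun m n => @expfzDr _ (omega R) m n (omega_neq0 R).
have Z2 : Z_R R x v ^+ 2 = \sum_(p : config * config)
    omega R ^ (ising_exponent x v p.1 + ising_exponent x v p.2).
  rewrite expr2 big_distrlr /= pair_bigA /=.
  by apply: eq_bigr => p _; rewrite [RHS]wD.
(* The norm on [R[i]] takes values in [R[i]] and is by definition the embedded [normc]. *)
rewrite rmorphXn /= (_ : (_%:C)%C = `|Z_R R x v|) //.
rewrite (exprM _ 2 2) -normrX normCK Z2 rmorph_sum big_distrlr /=.
apply: eq_bigr => p _; apply: eq_bigr => q _.
by rewrite conjC_omegaX -wD ising_exponent_defect.
Qed.

End Configurations.

Theorem mainTheorem7 (R : realType) (n : nat) (hn : (0 < n)%N) :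
  uniform_expectation
    (fun wv : edge_weights n * vertex_weights n =>
       Normc.normc (Z_R R wv.1 wv.2) ^+ 4)
  <= 3 * 2 ^+ (2 * n).
Proof.
pose config := {ffun 'I_n -> bool}.
rewrite /uniform_expectation; set N : R := _%:R.
have N0 : 0 < N.
  by rewrite ltr0n; apply/card_gt0P; exists ([ffun=> ord0], [ffun=> ord0]).
rewrite ler_pdivrMr //.
pose good (p q : config * config) :=
  [forall e, edge_defect _ p q e == 0] && [forall k, vertex_defect _ p q k == 0].
have -> : \sum_(wv : edge_weights n * vertex_weights n)
      Normc.normc (Z_R R wv.1 wv.2) ^+ 4
    = \sum_p \sum_q (if good p q then N else 0).
  (* The expansion lives in [R[i]], so the real identity is proved after the injective embedding. *)
  apply: (@complexI R); rewrite rmorph_sum /=.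
  under eq_bigr do rewrite normc_Z_R4.
  rewrite exchange_big rmorph_sum /=; apply: eq_bigr => p _.
  rewrite exchange_big rmorph_sum /=; apply: eq_bigr => q _.
  rewrite sum_omega_weights; [|exact: edge_defect_range|exact: vertex_defect_range].
  by rewrite -/(good p q); case: ifP; rewrite ?rmorph_nat ?rmorph0.
have bound (p : config * config) : \sum_q (if good p q then N else 0) <= N *+ 2.
  (* When [p.1 = p.2] the two indicators coincide and [p] is counted twice, which is harmless for an
     upper bound. *)
  apply: (@le_trans _ _ (\sum_q ((if q == p then N else 0)
                              + (if q == (p.2, p.1) then N else 0)))).
    apply: ler_sum => q _; case: ifPn => [/andP[/forallP E /forallP V]|_].
      have [e|e] : q = p \/ q = (p.2, p.1).
      + by apply: defect0_swap => k; apply/eqP.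
      + by rewrite e eqxx lerDl; case: ifP => // _; apply: ltW.
      + by rewrite e eqxx lerDr; case: ifP => // _; apply: ltW.
    by apply: addr_ge0; case: ifP => // _; apply: ltW.
  by rewrite big_split /= -!big_mkcond !big_pred1_eq mulr2n.
apply: (le_trans (ler_sum _ (fun p _ => bound p))).
rewrite sumr_const card_prod card_ffun card_bool card_ord -expnD addnn -mul2n.
rewrite -(mulr_natr (N *+ 2)) natrX -(mulr_natr N).
(* The total is at most [2 * N * 2 ^+ (2 * n)]; nonnegativity lets the factor 2 be raised to 3. *)
have : 0 <= N * 2 ^+ (2 * n) by apply: mulr_ge0; rewrite ?exprn_ge0 ?ltW.
move: (2 ^+ (2 * n)) => y; lra.
Qed.
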